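(* For every tolerance $\varepsilon\in(0,1)$ and every dimension $d\in\mathbb{N}$, the information complexity of multivariate integration in $F_d$, for both the normalized and the absolute error criteria, satisfies $$N^{\mathrm{nor}}(\varepsilon,d)\leq (8c_{\mathbb{P}}^{-1})^3\,\varepsilon^{-3}d^3\quad\text{and}\quad N^{\mathrm{abs}}(\varepsilon,d)\leq (8c_{\mathbb{P}}^{-1})^3\,\varepsilon^{-3}d^3 .$$
   Context: $\mathbb{N}$ denotes the positive integers and $\log$ is the natural logarithm. Constant: for an integer $M\geq 2$, $\mathbb{P}_M:=\{p \text{ prime} : \lceil M/2\rceil<p\leq M\}$. By results of Rosser and Schoenfeld there exist absolute constants $0<c_{\mathbb{P}}<1$ and $C_{\mathbb{P}}>1$ such that $c_{\mathbb{P}}\frac{M}{\log M}\leq |\mathbb{P}_M|\leq C_{\mathbb{P}}\frac{M}{\log M}$ for every integer $M\geq 2$; $c_{\mathbb{P}}$ is fixed as such a constant. Function space: for $f\in L^2([0,1)^d)$ (real-valued) and $\boldsymbol{k}\in\mathbb{Z}^d$, let $\hat f(\boldsymbol{k})=\int_{[0,1)^d}f(\boldsymbol{x})\exp(-2\pi i\,\boldsymbol{k}\cdot\boldsymbol{x})\,\mathrm{d}\boldsymbol{x}$ and $\mathrm{supp}(\boldsymbol{k})=\{j\in\{1,\ldots,d\} : k_j\neq 0\}$. Define $$F_d=\Big\{f\in L^2([0,1)^d) : \|f\|:=\sum_{\boldsymbol{k}\in\mathbb{Z}^d}|\hat f(\boldsymbol{k})|\max\Big(1,\min_{j\in\mathrm{supp}(\boldsymbol{k})}\log|k_j|\Big)<\infty\Big\},$$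 where for $\boldsymbol{k}=\boldsymbol{0}$ (empty support) the factor $\max(\cdot)$ is taken to be $1$. Since the Fourier series of $f\in F_d$ converges absolutely, $f$ is identified with the (continuous) sum of its Fourier series, so point values $f(\boldsymbol{x})$ are well defined. Errors and information complexity: let $I_d(f)=\int_{[0,1)^d}f(\boldsymbol{x})\,\mathrm{d}\boldsymbol{x}$. A linear cubature algorithm with $N\in\mathbb{N}$ function evaluations is $Q_{d,N}(f)=\sum_{n=1}^N w_n f(\boldsymbol{x}_n)$ with nodes $\boldsymbol{x}_1,\ldots,\boldsymbol{x}_N\in[0,1)^d$ and weights $w_1,\ldots,w_N\in\mathbb{R}$. The initial error is $e^{\mathrm{wor}}(F_d,\emptyset)=\sup_{f\in F_d,\ \|f\|\leq 1}|I_d(f)|$ and the worst-case error of $Q_{d,N}$ is $e^{\mathrm{wor}}(F_d,Q_{d,N})=\sup_{f\in F_d,\ \|f\|\leq 1}|I_d(f)-Q_{d,N}(f)|$. The information complexities for the normalized and absolute error criteria are $$N^{\mathrm{nor}}(\varepsilon,d)=\inf\{N\in\mathbb{N} : \exists\, Q_{d,N}\text{ with } e^{\mathrm{wor}}(F_d,Q_{d,N})\leq\varepsilon\, e^{\mathrm{wor}}(F_d,\emptyset)\},$$ $$N^{\mathrm{abs}}(\varepsilon,d)=\inf\{N\in\mathbb{N} : \exists\, Q_{d,N}\text{ with } e^{\mathrm{wor}}(F_d,Q_{d,N})\leq\varepsilon\}.$$ *)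

(* Defs.v *)
From HB Require Import structures.
From mathcomp Require Import all_boot all_order all_algebra.
From mathcomp Require Import complex.
From mathcomp Require Import all_classical all_reals all_analysis.
From mathcomp Require summability.

Set Implicit Arguments.
Unset Strict Implicit.
Unset Printing Implicit Defensive.

Import Order.TTheory GRing.Theory Num.Theory.
Import numFieldNormedType.Exports.

Local Open Scope classical_set_scope.
Local Open Scope ring_scope.

(* uphalf M is the ceiling of M / 2 *)
Definition primes_upper_half (M : nat) : seq nat :=
  [seq p <- iota 0 M.+1 | prime p & (uphalf M < p <= M)%N].

(* The two-sided bound satisfied by the Rosser-Schoenfeld constants. *)
Definition prime_count_constants (R : realType) (c C : R) : Prop :=
  [/\ 0 < c < 1, 1 < C &
    forall M : nat, (2 <= M)%N ->
      c * (M%:R / ln M%:R) <= (size (primes_upper_half M))%:R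
                           <= C * (M%:R / ln M%:R)].

Section unit_interval.
Context {R : realType}.

Definition lebesgue01 : set (measurableTypeR R) -> \bar R :=
  mrestr lebesgue_measure (measurable_itv `[0 : R, 1[%R).

HB.instance Definition _ := Measure.on lebesgue01.

Lemma lebesgue01_setT : lebesgue01 [set: _] = 1%E.
Proof.
rewrite /lebesgue01 /mrestr setTI lebesgue_measure_itv/= lte_fin ltr01.
by rewrite oppr0 adde0.
Qed.

HB.instance Definition _ :=
  Measure_isProbability.Build _ _ _ lebesgue01 lebesgue01_setT.

End unit_interval.

Section cube_measure.
Context {R : realType}.

Definition tuple_cons d (p : measurableTypeR R * d.-tuple (measurableTypeR R)) :
  d.+1.-tuple (measurableTypeR R) := [the d.+1.-tuple _ of p.1 :: p.2].

Lemma measurable_tuple_cons d : measurable_fun [set: _] (@tuple_cons d).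
Proof. exact: measurable_cons. Qed.

HB.instance Definition _ d :=
  isMeasurableFun.Build _ _ _ _ (@tuple_cons d) (@measurable_tuple_cons d).

(* Lebesgue measure on R^d restricted to [0,1)^d, as the d-fold product of
   lebesgue01: the pushforward of lebesgue01 \x cube_measure d along the
   isomorphism R * R^d -> R^(d+1). *)
Fixpoint cube_measure (d : nat) :
    probability (d.-tuple (measurableTypeR R)) R :=
  match d with
  | 0 => \d_ [tuple]
  | d'.+1 => distribution (lebesgue01 \x cube_measure d')%E (@tuple_cons d')
  end.

Lemma cube_measure_box d (A : 'I_d -> set (measurableTypeR R)) :
  (forall j, measurable (A j)) ->
  cube_measure d [set x | forall j, A j (tnth x j)] =
    (\prod_(j < d) lebesgue_measure (A j `&` [set y : R | (0 <= y < 1)%R]))%E.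
Proof.
elim: d A => [|d IH] A mA.
  by rewrite big_ord0 /= diracE mem_set//= => -[].
have mbox : measurable [set x | forall j : 'I_d, A (lift ord0 j) (tnth x j)].
  rewrite [X in measurable X](_ : _ = \bigcap_(j in [set: 'I_d])
      ((fun x => tnth x j) @^-1` A (lift ord0 j))).
    apply: fin_bigcap_measurable => // j _; rewrite -[X in measurable X]setTI.
    exact: measurable_tnth.
  by apply/seteqP; split => x /= h j; [move=> _|]; exact: h.
rewrite big_ord_recl /= /distribution /pushforward/= -IH//.
have -> : lebesgue_measure (A ord0 `&` [set y : R | 0 <= y < 1]) =
    lebesgue01 (A ord0).
  by rewrite /lebesgue01 /mrestr set_itvE.
rewrite -product_measure1E//; congr (_ _); apply/seteqP; split => -[x y]/= h.
  split; first exact: (h ord0).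
  by move=> j; have := h (lift ord0 j); rewrite tnthS.
by move=> j; case: (unliftP ord0 j) => [i ->|->]; [rewrite tnthS; apply: h.2|apply: h.1].
Qed.

End cube_measure.

Section fourier.
Context {R : realType}.
Variable d : nat.
Implicit Types (f : d.-tuple (measurableTypeR R) -> R)
  (k : d.-tuple int) (x : d.-tuple (measurableTypeR R)).

Definition in_cube x : Prop := forall j, 0 <= tnth x j < 1.

Definition dot k x : R := \sum_(j < d) (tnth k j)%:~R * tnth x j.

(* exp(i t) *)
Definition cis (t : R) : R[i] := (cos t +i* sin t)%C.

Definition cube_integral f : R := \int[cube_measure d]_x f x.

Definition complex_cube_integral
    (g : d.-tuple (measurableTypeR R) -> R[i]) : R[i] :=
  (cube_integral (fun x => complex.Re (g x)) +i*
   cube_integral (fun x => complex.Im (g x)))%C.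

Definition fourier_coef f k : R[i] :=
  complex_cube_integral
    (fun x => ((f x)%:C)%C * cis (- (2 * pi * dot k x))).

Definition supp k : {set 'I_d} := [set j | tnth k j != 0].

(* The infimum is a minimum, over a finite nonempty set. *)
Definition frequency_weight k : R :=
  if supp k == finset.set0 then 1
  else Num.max 1 (inf [set ln `|(tnth k j)%:~R| | j in [set` supp k]]).

Definition fourier_norm f : \bar R :=
  (\esum_(k in [set: d.-tuple int])
     (Normc.normc (fourier_coef f k) * frequency_weight k)%:E)%E.

(* Elements of L^2 are given by Borel representatives on R^d; as cube_measure
   lives on [0,1)^d, only their restriction to the cube matters. *)
Definition fourier_space f : Prop :=
  f \in Lfun (cube_measure d) 2%:E /\ (fourier_norm f < +oo)%E.

(* Unordered sum over Z^d: limit of the sums over finite sets of frequencies. *)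
Definition frequency_sum (u : d.-tuple int -> R) : R :=
  @summability.sum _ R R^o u.

(* The value at x of the sum of the Fourier series of f. An element f of the
   function space is identified with this sum, so that this, and not f x for
   the chosen L^2 representative, is the point value of f; the sum is real
   because f is real-valued. *)
Definition point_value f x : R :=
  frequency_sum
    (fun k => complex.Re (fourier_coef f k * cis (2 * pi * dot k x))).

Definition cubature N (w : 'I_N -> R)
    (t : 'I_N -> d.-tuple (measurableTypeR R)) f : R :=
  \sum_(n < N) w n * point_value f (t n).

Definition unit_ball : set (d.-tuple (measurableTypeR R) -> R) :=
  [set f | fourier_space f /\ (fourier_norm f <= 1)%E].

Definition initial_error : \bar R :=
  ereal_sup [set `|cube_integral f|%:E | f in unit_ball].

Definition worst_case_error N (w : 'I_N -> R)
    (t : 'I_N -> d.-tuple (measurableTypeR R)) : \bar R :=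
  ereal_sup [set `|cube_integral f - cubature w t f|%:E | f in unit_ball].

(* The infimum, with value +oo on the empty set, of the positive N admitting
   an N-point linear cubature algorithm with worst-case error at most e. *)
Definition information_complexity (e : \bar R) : \bar R :=
  ereal_inf [set N%:R%:E | N in [set N : nat | (0 < N)%N /\
    exists (w : 'I_N -> R) (t : 'I_N -> d.-tuple (measurableTypeR R)),
      (forall n, in_cube (t n)) /\ (worst_case_error w t <= e)%E]].

End fourier.

Definition N_nor (R : realType) (eps : R) (d : nat) : \bar R :=
  information_complexity d (eps%:E * initial_error d)%E.

Definition N_abs (R : realType) (eps : R) (d : nat) : \bar R :=
  information_complexity d eps%:E.

(* Main.v *)
Require Import Defs.
From mathcomp Require Import all_boot all_order all_algebra.
From mathcomp Require Import finmap complex.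
From mathcomp Require Import all_classical all_reals all_analysis.
From mathcomp Require Import measurable_realfun.
From mathcomp Require Import ring lra zify.
From mathcomp Require summability.

Set Implicit Arguments.
Unset Strict Implicit.
Unset Printing Implicit Defensive.

Import Order.TTheory GRing.Theory Num.Theory.
Import numFieldNormedType.Exports.
Local Open Scope classical_set_scope.
Local Open Scope ring_scope.

(** An element f of the space enters the error only through its Fourier
    coefficients.  The integral is the coefficient at frequency 0, so for weights
    of sum 1 the integration error is minus the sum, over the nonzero frequencies
    k, of the coefficient at k times the value of the cubature rule on the
    character x |-> exp(2 pi i k.x).  If that value is at most e * weight(k) for
    every k <> 0, then the worst-case error is at most e, because the norm is
    exactly the weighted sum of the absolute values of the coefficients
    ([worst_case_error_le]).

    The rule averages, over the primes p in (M/2, M], the p^2 points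
    ({k n / p}, ..., {k n^d / p}) with 0 <= k, n < p.  Summing a character h over
    k gives p or 0 according to whether p divides the integer
    h_1 n + ... + h_d n^d.  Hence the average over one p-set is the proportion of
    roots modulo p of a polynomial of degree at most d, which is at most
    d / p <= 2 d / M unless p divides all the h_j ([count_roots_le]).  In that
    exceptional case it is bounded by 1, and exceptional primes are rare: their
    product divides every nonzero h_j, so there are at most
    log |h_j| / log (M/2) of them ([size_prime_divisors_ln_le]).  This is where
    the logarithmic weight comes from.  Since there are at least c M / log M
    primes in (M/2, M], the value on the character h is at most
    (4 d / (c M)) * weight(h) ([korobov_rule_error_le]).

    With M the integer part of 8 d / (c eps), this is at most eps * weight(h), and
    the number of nodes is at most M^2 for each of at most M primes, hence at most
    M^3.  The bound for the absolute criterion implies the one for the normalized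
    criterion as soon as the initial error is at least 1; the constant function 1
    has norm 1 because its Fourier coefficients vanish outside 0, which follows
    from Fubini's theorem one coordinate at a time ([integral_cos_dot]). *)

#[local] Existing Instance summability.totally_filter.

(** * Unordered sums *)

Section unordered_sum.
Context {R : realType} {I : choiceType}.
Implicit Types (u v : I -> R) (A B : {fset I}).

Let psum u : {fset I} -> R := @summability.partial_sum I R^o u.

Lemma partial_sumE u A : psum u A = \sum_(i <- A) u i.
Proof. by rewrite (big_seq_fsetE _ _ xpredT u). Qed.

Lemma le_partial_sum u A B :
  (forall i, 0 <= u i) -> (A `<=` B)%fset -> psum u A <= psum u B.
Proof.
move=> u0 AB; rewrite !partial_sumE (big_fsetID _ (mem A) B)/=.
rewrite (_ : [fset x in B | x \in A]%fset = A)/=; last first.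
  apply/fsetP => x; rewrite !inE/= andbC; case: (boolP (x \in A)) => //=.
  by move=> /(fsubsetP AB) ->.
by rewrite lerDl sumr_ge0.
Qed.

Lemma partial_sum_cvg_ge0 u (C : R) : (forall i, 0 <= u i) ->
  (forall A, psum u A <= C) -> cvg (psum u @ summability.totally).
Proof.
move=> u0 uC; apply/cvg_ex; exists (sup (range (psum u))).
have hs : has_sup (range (psum u)).
  split; first by exists (psum u fset0); exists fset0.
  by exists C => _ [A _ <-].
apply/cvgrPdist_le => e e0.
have [_ [A _ <-] hA] := sup_adherent e0 hs.
exists A => // B /= AB; rewrite ger0_norm ?subr_ge0; last first.
  by apply: ub_le_sup; [exact: hs.2|exists B].
by rewrite lerBlDr -lerBlDl ltW// (lt_le_trans hA)// le_partial_sum.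
Qed.

(** Writing u as (|u| + u) - |u| reduces absolute convergence to the monotone
    case, where the partial sums tend to their supremum. *)
Lemma partial_sum_cvg u (C : R) :
  (forall A, psum (fun i => `|u i|) A <= C) -> cvg (psum u @ summability.totally).
Proof.
move=> uC.
have -> : psum u = (fun A => psum (fun i => `|u i| + u i) A - psum (fun i => `|u i|) A).
  apply/funext => A; rewrite /psum /summability.partial_sum -sumrB.
  by apply: eq_bigr => i _; rewrite addrAC subrr add0r.
apply: is_cvgB.
- apply: (@partial_sum_cvg_ge0 _ (C + C)) => [i|A].
    by rewrite -lerBlDr sub0r (le_trans (ler_norm _))// normrN.
  rewrite (le_trans _ (lerD (uC A) (uC A)))//.
  rewrite /psum /summability.partial_sum -big_split/= ler_sum// => i _.
  by rewrite lerD2l ler_norm.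
- exact: partial_sum_cvg_ge0 uC.
Qed.

End unordered_sum.

(** * Worst-case error in terms of characters *)

Section cubature_error.
Context {R : realType} {d : nat}.
Implicit Types (k : d.-tuple int) (f : d.-tuple (measurableTypeR R) -> R).

Lemma normc_cis (t : R) : Normc.normc (cis t) = 1.
Proof. by rewrite /cis/= cos2Dsin2 sqrtr1. Qed.

Lemma cis0 : cis (0 : R) = 1.
Proof. by rewrite /cis cos0 sin0. Qed.

Lemma cisD (a b : R) : cis (a + b) = cis a * cis b.
Proof.
rewrite /cis cosD sinD; apply/eqP.
by rewrite eq_complex/= eqxx/= addrC mulrC [sin b * _]mulrC.
Qed.

Lemma periodic_intr (f : R -> R) (t : R) (n : int) : periodic f (pi *+ 2) ->
  f (t + 2 * pi * n%:~R) = f t.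
Proof.
move=> pf; case: n => n.
  by rewrite -pmulrn mulr_natr mulr_natl periodicn.
rewrite NegzE mulrNz mulrN -pmulrn mulr_natr mulr_natl.
by rewrite -[in LHS](periodicn pf n.+1) subrK.
Qed.

Lemma cosD2pi_int (t : R) (n : int) : cos (t + 2 * pi * n%:~R) = cos t.
Proof. exact/periodic_intr/cosD2pi. Qed.

Lemma sinD2pi_int (t : R) (n : int) : sin (t + 2 * pi * n%:~R) = sin t.
Proof. exact/periodic_intr/sinD2pi. Qed.

Lemma cisD2pi_int (t : R) (n : int) : cis (t + 2 * pi * n%:~R) = cis t.
Proof. by rewrite /cis cosD2pi_int sinD2pi_int. Qed.

Lemma normr_Re_le (z : R[i]) : `|complex.Re z| <= Normc.normc z.
Proof.
by case: z => a b /=; rewrite -sqrtr_sqr ler_wsqrtr// lerDl sqr_ge0.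
Qed.

Lemma normc_ge0 (z : R[i]) : 0 <= Normc.normc z.
Proof. exact: le_trans (normr_Re_le z). Qed.

Lemma Re_sum_scale (J : Type) (s : seq J) (a : J -> R) (z : R[i]) (b : J -> R[i]) :
  complex.Re (z * \sum_(i <- s) (a i)%:C%C * b i) =
  \sum_(i <- s) a i * complex.Re (z * b i).
Proof.
rewrite mulr_sumr; elim: s => [|i s IH]; first by rewrite !big_nil.
rewrite !big_cons -IH raddfD/=; congr (_ + _).
by case: z {IH} (b i) => [x y] [u v] /=; ring.
Qed.

Lemma frequency_weight_ge1 k : 1 <= frequency_weight (R := R) k.
Proof. by rewrite /frequency_weight; case: ifP => // _; rewrite le_max lexx. Qed.

Lemma frequency_weight_ge0 k : 0 <= frequency_weight (R := R) k.
Proof. exact: le_trans (frequency_weight_ge1 k). Qed.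

Definition zero_frequency : d.-tuple int := nseq_tuple d 0.

Lemma dot0 x : dot (R := R) zero_frequency x = 0.
Proof.
by rewrite /dot big1// => j _; rewrite /zero_frequency tnth_nseq mul0r.
Qed.

Lemma frequency_weight0 : frequency_weight (R := R) zero_frequency = 1.
Proof.
rewrite /frequency_weight ifT//; apply/eqP/setP => j.
by rewrite /supp !inE tnth_nseq eqxx.
Qed.

(** This is what lets the integral cancel the frequency 0 term of a cubature rule
    whose weights sum to 1. *)
Lemma cube_integralE f : cube_integral f = complex.Re (fourier_coef f zero_frequency).
Proof.
rewrite /fourier_coef /=; congr cube_integral; apply/funext => x.
by rewrite dot0 mulr0 oppr0 cos0 sin0 mulr1 mulr0 subr0.
Qed.

Lemma fourier_norm_fset f (A : {fset d.-tuple int}) :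
  unit_ball f ->
  \sum_(k <- A) Normc.normc (fourier_coef f k) * frequency_weight k <= 1.
Proof.
move=> [_]; rewrite /fourier_norm => h.
rewrite -lee_fin; apply: le_trans h.
apply: ereal_sup_ubound; exists [set` A]; first by split => //; exact: finite_fset.
by rewrite fsbig_finite//= set_fsetK sumEFin.
Qed.

Lemma partial_sum_Re_bounded f x (A : {fset d.-tuple int}) : unit_ball f ->
  @summability.partial_sum _ R^o (fun k =>
    `|complex.Re (fourier_coef f k * cis (2 * pi * dot k x))|) A <= 1.
Proof.
move=> /fourier_norm_fset fA; rewrite partial_sumE.
apply: le_trans (fA A); apply: ler_sum => k _; apply: le_trans (normr_Re_le _) _.
rewrite Normc.normcM normc_cis mulr1 ler_peMr ?frequency_weight_ge1//.
exact: normc_ge0.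
Qed.

(** Every point value is a limit of partial Fourier sums over finite sets of
    frequencies, so it is enough to bound the error of the partial sums.  Once the
    set contains 0, the term at 0 cancels the integral because the weights sum to
    1, and the remaining terms are controlled by the norm. *)
Lemma worst_case_error_le N (w : 'I_N -> R) t (e : R) : 0 <= e ->
  \sum_(n < N) w n = 1 ->
  (forall k, k != zero_frequency ->
    Normc.normc (\sum_(n < N) (w n)%:C%C * cis (2 * pi * dot k (t n))) <=
      e * frequency_weight k) ->
  (worst_case_error w t <= e%:E)%E.
Proof.
move=> e0 w1 hk; apply: ge_ereal_sup => _ [f fB <-]; rewrite lee_fin.
pose u n k := complex.Re (fourier_coef f k * cis (2 * pi * dot k (t n))).
have ucvg n : @summability.partial_sum _ R^o (u n) @ summability.totally -->
    point_value f (t n).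
  by apply: (@partial_sum_cvg _ _ _ 1) => A; exact: partial_sum_Re_bounded.
have errcvg : (fun A => `|cube_integral f -
      \sum_(n < N) w n * @summability.partial_sum _ R^o (u n) A|)
    @ summability.totally --> `|cube_integral f - cubature w t f|.
  apply: cvg_norm; apply: cvgB; first exact: cvg_cst.
  apply: (cvg_big add_continuous) => n _.
  by apply: cvgM; [exact: cvg_cst|exact: ucvg].
apply: (cvgr_to_le errcvg).
exists [fset zero_frequency]%fset => // A /=; rewrite fsub1set => A0.
have -> : cube_integral f -
    \sum_(n < N) w n * @summability.partial_sum _ R^o (u n) A =
    - \sum_(k <- A | k != zero_frequency) complex.Re (fourier_coef f k *
        \sum_(n < N) (w n)%:C%C * cis (2 * pi * dot k (t n))).
  under eq_bigr do rewrite partial_sumE mulr_sumr.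
  rewrite exchange_big/= cube_integralE (bigD1_seq _ A0)//=.
  under eq_bigr do rewrite /u dot0 mulr0 cis0 mulr1.
  rewrite -mulr_suml w1 mul1r opprD addrA subrr add0r; congr (- _).
  by apply: eq_bigr => k _; rewrite Re_sum_scale.
rewrite normrN (le_trans (ler_norm_sum _ _ _))//.
apply: (@le_trans _ _ (\sum_(k <- A | k != zero_frequency)
    e * (Normc.normc (fourier_coef f k) * frequency_weight k))).
  apply: ler_sum => k k0; apply: le_trans (normr_Re_le _) _.
  by rewrite Normc.normcM mulrCA ler_wpM2l ?normc_ge0// hk.
rewrite -mulr_sumr -[leRHS]mulr1 ler_wpM2l//.
apply: le_trans (fourier_norm_fset A fB).
rewrite [leRHS](bigID (fun k => k != zero_frequency))/= lerDl sumr_ge0// => k _.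
by rewrite mulr_ge0 ?normc_ge0 ?frequency_weight_ge0.
Qed.

End cubature_error.

(** * Integrals of characters over the cube *)

Section character_integral.
Context {R : realType}.

Lemma integral_lebesgue01 (f : R -> \bar R) :
  lebesgue01.-integrable [set: R] f ->
  (\int[lebesgue01]_x f x = \int[lebesgue_measure]_(x in `[0%R, 1%R[) f x)%E.
Proof.
move=> intf.
rewrite (@negligible_integral _ _ _ lebesgue01 setT (~` `[0%R, 1%R[))//=; last 2 first.
- exact: measurableC.
- by rewrite /lebesgue01 /mrestr setICl measure0.
rewrite setTD setCK; apply: eq_measure_integral => A mA A01.
congr (lebesgue_measure _); exact: setIidl.
Qed.

Lemma bounded_integrable d (T : measurableType d) (P : probability T R)
    (f : T -> R) (C : R) : measurable_fun [set: T] f ->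
  (forall x, `|f x| <= C) -> P.-integrable [set: T] (EFin \o f).
Proof.
move=> mf fC; apply: (@le_integrable _ _ _ _ setT _ _ (EFin \o cst C)) => //.
- exact/measurable_EFinP.
- by move=> x _; rewrite /= lee_fin (le_trans (fC x))// ler_norm.
- exact: finite_measure_integrable_cst.
Qed.

Lemma measurable_cos_comp d (T : measurableType d) (g : T -> R) :
  measurable_fun [set: T] g -> measurable_fun [set: T] (fun x => cos (g x)).
Proof.
move=> mg; apply: (measurableT_comp _ mg).
exact: (continuous_measurable_fun (@continuous_cos R)).
Qed.

Lemma integral_cos_interval (a t : R) : a != 0 ->
  sin (a + t) = sin t ->
  (\int[lebesgue01]_y (cos (a * y + t))%:E = 0)%E.
Proof.
move=> a0 per; rewrite integral_lebesgue01; last first.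
  apply: (@bounded_integrable _ _ _ _ 1) => [|x]; last exact: cos_max.
  apply: measurable_cos_comp.
  by apply: measurable_funD => //; apply: measurable_funM.
have dg x : is_derive x (1:R) (fun y : R => a * y + t) a.
  apply: is_derive_eq.
  by rewrite addr0 /GRing.scale/= mulr1.
have dF x : is_derive x (1:R) (fun y => a^-1 * sin (a * y + t)) (cos (a * x + t)).
  have ds := is_derive1_comp (is_derive_sin _) (dg x).
  apply: is_derive_eq; rewrite /GRing.scale/=.
  by rewrite mulrCA mulVf// mulr1.
have cF x : {for x, continuous (fun y => a^-1 * sin (a * y + t))}.
  exact/differentiable_continuous/derivable1_diffP.
have cf : continuous (fun y => cos (a * y + t)).
  move=> x; apply: (@continuous_comp _ _ _ (fun y => a * y + t) cos).
    exact/differentiable_continuous/derivable1_diffP.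
  exact: continuous_cos.
rewrite integral_itv_bndo_bndc; last first.
  apply/measurable_EFinP/measurable_funTS.
  exact: continuous_measurable_fun.
rewrite (@continuous_FTC2 _ _ (fun y => a^-1 * sin (a * y + t)))//.
- by rewrite mulr1 mulr0 add0r per subee.
- exact: continuous_subspaceT.
- split => [x _| |]; first exact: ex_derive.
  + exact/cvg_at_right_filter/cF.
  + exact/cvg_at_left_filter/cF.
- by move=> x _; rewrite derive1E derive_val.
Qed.

(** Fubini in both orders: depending on the frequency, the inner integral known to
    vanish is the one over the first coordinate or the one over the others. *)
Lemma integral_cube_measureS d (f : d.+1.-tuple (measurableTypeR R) -> R) (C : R) :
  measurable_fun setT f -> (forall x, `|f x| <= C) ->
  (\int[cube_measure d.+1]_x (f x)%:E =
    \int[lebesgue01]_y \int[cube_measure d]_x (f (tuple_cons (y, x)))%:E)%E /\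
  (\int[cube_measure d.+1]_x (f x)%:E =
    \int[cube_measure d]_x \int[lebesgue01]_y (f (tuple_cons (y, x)))%:E)%E.
Proof.
move=> mf fC.
have mfc : measurable_fun setT (f \o @tuple_cons R d).
  by apply: measurableT_comp => //; exact: measurable_tuple_cons.
have ifc : (lebesgue01 \x cube_measure d)%E.-integrable setT
    (EFin \o (f \o @tuple_cons R d)).
  by apply: (@bounded_integrable _ _ _ _ C) => // x; exact: fC.
rewrite /= integral_distribution//; last exact/measurable_EFinP.
split.
- exact: (etrans (esym (integral12_prod_meas1 ifc))).
- exact: (etrans (esym (integral21_prod_meas1 ifc))).
Qed.

Lemma measurable_dot d (k : d.-tuple int) :
  measurable_fun setT (fun x : d.-tuple (measurableTypeR R) => dot k x).
Proof.
apply: measurable_sum => j; apply: measurable_funM => //.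
exact: measurable_tnth.
Qed.

Lemma dot_cons d (k : d.+1.-tuple int) (y : R) (x : d.-tuple (measurableTypeR R)) :
  dot k (tuple_cons (y, x)) = (thead k)%:~R * y + dot (behead_tuple k) x.
Proof.
rewrite [in LHS](tuple_eta k) /dot big_ord_recl /= !tnth0; congr (_ + _).
by apply: eq_bigr => j _; rewrite !tnthS.
Qed.

(** The phase t makes the induction work: after fixing all coordinates but the one
    that is integrated, they only contribute to the phase.  It also covers the
    sine, which is the cosine with phase pi / 2. *)
Lemma integral_cos_dot d (k : d.-tuple int) (t : R) : k != zero_frequency ->
  (\int[cube_measure d]_x (cos (2 * pi * dot k x + t))%:E = 0)%E.
Proof.
elim: d k t => [|d IH] k t k0.
  by rewrite (tuple0 k) (tuple0 zero_frequency) eqxx in k0.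
have mc : measurable_fun setT
    (fun x : d.+1.-tuple (measurableTypeR R) => cos (2 * pi * dot k x + t)).
  apply: measurable_cos_comp; apply: measurable_funD => //.
  by apply: measurable_funM => //; exact: measurable_dot.
have [E1 E2] := integral_cube_measureS mc (fun x => cos_max _).
have [a0|a0] := eqVneq (thead k) 0.
(* The first coordinate does not occur, so the inner integral over the others
   vanishes by induction; otherwise the inner integral over it vanishes. *)
- rewrite E1; apply: integral0_eq => y _.
  under eq_integral do rewrite dot_cons a0 mul0r add0r.
  apply: IH; apply: contra k0 => /eqP k0; apply/eqP.
  by apply: val_inj; rewrite (tuple_eta k) /= a0; move/(congr1 val): k0 => /= ->.
- rewrite E2; apply: integral0_eq => x _.
  under eq_integral do rewrite dot_cons mulrDr [_ * (_ * _)]mulrA -addrA.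
rewrite integral_cos_interval//.
    by rewrite !mulf_neq0 ?pnatr_eq0 ?intr_eq0// gt_eqF// pi_gt0.
  by rewrite [_ * (thead k)%:~R + _]addrC sinD2pi_int.
Qed.

End character_integral.

(** * The initial error *)

Section initial_error.
Context {R : realType} {d : nat}.

Lemma fourier_coef_cst1 (k : d.-tuple int) :
  fourier_coef (cst (1 : R)) k = if k == zero_frequency then 1 else 0.
Proof.
have Recoef : complex.Re (fourier_coef (cst (1 : R)) k) =
    fine (\int[cube_measure d]_x (cos (2 * pi * dot k x + 0))%:E)%E.
  rewrite /fourier_coef /complex_cube_integral /cube_integral /Rintegral /=.
  by congr fine; apply: eq_integral => x _; rewrite cosN mul1r mul0r subr0 addr0.
have Imcoef : complex.Im (fourier_coef (cst (1 : R)) k) =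
    fine (\int[cube_measure d]_x (cos (2 * pi * dot k x + pi / 2))%:E)%E.
  rewrite /fourier_coef /complex_cube_integral /cube_integral /Rintegral /=.
  by congr fine; apply: eq_integral => x _; rewrite sinN mul1r mul0r addr0 cosDpihalf.
have [->{Recoef Imcoef}|k0] := eqVneq k zero_frequency; last first.
  apply/eqP; rewrite eq_complex Recoef Imcoef !integral_cos_dot//=.
  by rewrite eqxx.
rewrite /fourier_coef (_ : (fun x => _) = cst 1); last first.
  by apply/funext => x; rewrite dot0 mulr0 oppr0 cis0 mulr1.
rewrite /complex_cube_integral /cube_integral /= !Rintegral_cst//= mul0r.
by rewrite probability_setT/= mul1r.
Qed.

Lemma initial_error_ge1 : (1 <= initial_error (R := R) d)%E.
Proof.
have I1 : cube_integral (R := R) (cst 1 : d.-tuple (measurableTypeR R) -> R) = 1.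
  by rewrite cube_integralE fourier_coef_cst1 eqxx.
have n1 : fourier_norm (cst 1 : d.-tuple (measurableTypeR R) -> R) = 1%E.
  have <- : (\esum_(k in [set @zero_frequency d]) 1 = 1 :> \bar R)%E by rewrite esum_set1.
  rewrite esum_mkcond; apply: eq_esum => k _.
  rewrite fourier_coef_cst1; case: eqVneq => [->|k0].
    by rewrite mem_set// Normc.normc1 frequency_weight0 mul1r.
  by rewrite memNset ?Normc.normc0 ?mul0r// => /eqP; exact/negP.
apply: ereal_sup_ubound; exists (cst 1); last by rewrite I1 normr1.
split; last by rewrite n1.
by split; [exact: Lfun_cst|rewrite n1 ltry].
Qed.

End initial_error.

(** * Exponential sums *)

Section exponential_sums.
Context {R : realType}.

Lemma cisX (t : R) n : cis (t * n%:R) = cis t ^+ n.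
Proof.
elim: n => [|n IH]; first by rewrite mulr0 cis0.
by rewrite exprS -IH -cisD -[n.+1]addn1 natrD mulrDr mulr1 addrC.
Qed.

Lemma normc_sum_le (J : Type) (s : seq J) (P : pred J) (F : J -> R[i]) :
  Normc.normc (\sum_(i <- s | P i) F i) <= \sum_(i <- s | P i) Normc.normc (F i).
Proof.
elim/big_ind2: _ => [|x a y b xa yb|//]; first by rewrite Normc.normc0.
exact: le_trans (le_normcD _ _) (lerD xa yb).
Qed.

Lemma normc_scale (a : R) (z : R[i]) : 0 <= a ->
  Normc.normc (a%:C%C * z) = a * Normc.normc z.
Proof.
move=> a0; rewrite Normc.normcM; congr (_ * _).
by rewrite /= expr0n/= addr0 sqrtr_sqr ger0_norm.
Qed.

Lemma cos_lt1 (x : R) : 0 < x < 2 * pi -> cos x < 1.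
Proof.
move=> /andP[x0 x2]; have -> : x = (x / 2) *+ 2 by rewrite -mulr_natr divfK.
have s0 : 0 < sin (x / 2) by apply: sin_gt0_pi; lra.
rewrite cos_mulr2n cos2sin2; have : 0 < sin (x / 2) ^+ 2 by rewrite exprn_gt0.
lra.
Qed.

(** Reducing b modulo p puts the angle strictly between 0 and 2 pi, where the
    cosine is smaller than 1. *)
Lemma cis_neq1 (p : nat) (b : int) : ~~ (p %| `|b|)%N -> (0 < p)%N ->
  cis (2 * pi * (b%:~R / p%:R) : R) != 1.
Proof.
move=> pb p0.
have pR : (0 : R) < p%:R by rewrite ltr0n.
have p0z : (p : int) != 0 by rewrite eqz_nat -lt0n.
have r0 : 0 < (b %% p)%Z.
  rewrite lt_neqAle modz_ge0// andbT eq_sym; apply: contra pb => /eqP bp.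
  by rewrite -[(p %| _)%N]/(p%:Z %| b)%Z; apply/dvdz_mod0P.
have rp : (b %% p)%Z < p by rewrite ltz_pmod// ltz_nat.
have -> : b%:~R / p%:R = ((b %% p)%Z)%:~R / p%:R + ((b %/ p)%Z)%:~R :> R.
  rewrite {1}(divz_eq b p) intrD intrM mulrDl -[(p : int)%:~R]/(p%:R) mulfK ?gt_eqF//.
  by rewrite addrC.
rewrite mulrDr cisD2pi_int; apply/negP => /eqP[c1 _].
have : cos (2 * pi * (((b %% p)%Z)%:~R / p%:R)) < 1 :> R.
  apply: cos_lt1; rewrite !mulr_gt0 ?pi_gt0 ?ltr0z ?invr_gt0//=.
  rewrite -[ltRHS]mulr1 ltr_pM2l ?mulr_gt0 ?pi_gt0// ltr_pdivrMr// mul1r.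
  by rewrite (_ : p%:R = (p : int)%:~R)// ltr_int.
by rewrite c1 ltxx.
Qed.

(** A geometric sum over a p-th root of unity: it vanishes unless the root is 1,
    that is, unless p divides b. *)
Lemma normc_character_sum_le (p : nat) (b : int) : (0 < p)%N ->
  Normc.normc (\sum_(k <- iota 0 p) cis (2 * pi * (b%:~R / p%:R) : R) ^+ k) <=
    ((p %| `|b|) * p)%N%:R.
Proof.
move=> p0; have [pb|pb] := boolP (p %| `|b|)%N; rewrite ?(mul1n, mul0n).
  apply: le_trans (normc_sum_le _ _ _) _.
  under eq_bigr do rewrite -cisX normc_cis.
  by rewrite big_const_seq count_predT size_iota iter_addr_0.
have zp : cis (2 * pi * (b%:~R / p%:R) : R) ^+ p = 1.
  have pR : p%:R != 0 :> R by rewrite pnatr_eq0 -lt0n.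
  by rewrite -cisX -!mulrA mulVf// mulr1 mulrA -[LHS]mul1r -cis0 -cisD cisD2pi_int.
have := subrX1 (cis (2 * pi * (b%:~R / p%:R) : R)) p.
rewrite zp subrr => /esym/eqP; rewrite mulf_eq0 subr_eq0 (negbTE (cis_neq1 pb p0))/=.
rewrite -(big_mkord xpredT (fun k => cis (2 * pi * (b%:~R / p%:R) : R) ^+ k)).
by rewrite /index_iota subn0 => /eqP ->; rewrite Normc.normc0.
Qed.

End exponential_sums.

(** * Roots of polynomials modulo a prime *)

(** The residues n counted here are distinct roots in the prime field of a
    polynomial of degree at most d, nonzero since p does not divide some h_j. *)
Lemma count_roots_le (d p : nat) (h : d.-tuple int) : prime p ->
  ~~ [forall j, (p %| `|tnth h j|)%N] ->
  (count (fun n => p %| `|(\sum_(j < d) tnth h j * (n ^ j.+1)%N%:Z)%R|)%N (iota 0 p) <= d)%N.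
Proof.
move=> pp; rewrite negb_forall => /existsP[j0 hj0].
have F0 (a : int) : ((a%:~R : 'F_p) == 0) = (p %| `|a|)%N.
  rewrite [a in LHS]intEsign rmorphM/= rmorph_sign mulf_eq0 signr_eq0/=.
  by rewrite -pmulrn (dvdn_pcharf (pchar_Fp pp)).
pose q : {poly 'F_p} := \sum_(j < d) (tnth h j)%:~R *: 'X^(j.+1).
have qj0 : q`_j0.+1 = (tnth h j0)%:~R.
  rewrite coef_sum (bigD1 j0)//= big1 => [|j jj0].
    by rewrite coefZ coefXn eqxx mulr1 addr0.
  by rewrite coefZ coefXn eqSS eq_sym (inj_eq val_inj) (negbTE jj0) mulr0.
have q0 : q != 0.
  by apply: contra hj0 => /eqP q0; rewrite -F0 -qj0 q0 coef0.
have sq : (size q <= d.+1)%N.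
  apply: leq_trans (size_sum _ _ _) _; apply/bigmax_leqP => j _.
  by rewrite (leq_trans (size_scale_leq _ _))// size_polyXn ltnS.
set a := (fun n => _).
pose rs := [seq n%:R : 'F_p | n <- iota 0 p & a n].
have : (size rs < size q)%N.
  apply: max_poly_roots => //.
    apply/allP => x /mapP[n]; rewrite mem_filter => /andP[an _] ->{x}.
    move: an; rewrite /a -F0 rmorph_sum/= rootE horner_sum => /eqP an.
    apply/eqP; rewrite -[RHS]an; apply: eq_bigr => j _.
    by rewrite hornerZ hornerXn rmorphM/= -pmulrn natrX.
  rewrite map_inj_in_uniq ?filter_uniq ?iota_uniq// => m n.
  rewrite !mem_filter !mem_iota/= !add0n => /andP[_ mp] /andP[_ np].
  move/(congr1 val); rewrite /= !val_Fp_nat// !modn_small//.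
rewrite size_map size_filter => /leq_trans/(_ sq).
by rewrite ltnS.
Qed.

(** * Prime divisors of a frequency *)

Section prime_divisors.
Context {R : realType}.

Lemma prod_primes_dvdn (s : seq nat) (m : nat) : uniq s -> all prime s ->
  {in s, forall p, p %| m}%N -> (\prod_(p <- s) p %| m)%N.
Proof.
elim: s => [|p s IH]; first by rewrite big_nil dvd1n.
move=> /=/andP[ps us] /andP[pp prs] hm; rewrite big_cons Gauss_dvd.
  rewrite hm ?mem_head//= IH// => q qs; apply: hm.
  by rewrite inE qs orbT.
rewrite coprime_sym.
elim: s ps prs {us IH hm} => [|q s IH]; first by rewrite big_nil coprime1n.
rewrite inE negb_or => /andP[pq ps] /=/andP[pr prs].
by rewrite big_cons coprimeMl IH// andbT prime_coprime// dvdn_prime2// eq_sym.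
Qed.

(** The product of distinct prime divisors divides m, and it is at least b to the
    power of their number. *)
Lemma size_primes_ln_le (s : seq nat) (m : nat) (b : R) : uniq s -> all prime s ->
  {in s, forall p, p %| m}%N -> (0 < m)%N -> 0 < b -> {in s, forall p, b <= p%:R} ->
  (size s)%:R * ln b <= ln m%:R.
Proof.
move=> us prs sm m0 b0 bs.
have : (\prod_(p <- s) p <= m)%N by rewrite dvdn_leq// prod_primes_dvdn.
rewrite -(ler_nat R) => pm; rewrite mulr_natl -lnXn//.
rewrite ler_ln ?posrE ?exprn_gt0 ?ltr0n//; apply: le_trans pm.
elim: s bs {us prs sm} => [|p s IH] bs; first by rewrite big_nil.
rewrite big_cons natrM /= exprS ler_pM ?exprn_ge0 ?(ltW b0)//.
  by rewrite bs ?mem_head.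
by apply: IH => q qs; rewrite bs// inE qs orbT.
Qed.

(** A prime dividing all components of h divides each nonzero one, so the bound
    holds with ln |h_j| for every j in the support, hence with their minimum.  The
    support is nonempty as h is nonzero. *)
Lemma size_prime_divisors_ln_le d (s : seq nat) (h : d.-tuple int) (b : R) :
  h != zero_frequency -> uniq s -> all prime s -> 1 <= b ->
  {in s, forall p, b <= p%:R} ->
  (size [seq p <- s | [forall j, (p %| `|tnth h j|)%N]])%:R * ln b <= frequency_weight h.
Proof.
move=> h0 us prs b1 bs; rewrite /frequency_weight.
case: ifPn => [/eqP supp0|/set0Pn[j0 hj0]].
  case/eqP: h0; apply: eq_from_tnth => j; rewrite tnth_nseq.
  have : (j \in supp h) = false by rewrite supp0 finset.in_set0.
  by rewrite inE => /negbFE/eqP.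
rewrite le_max; apply/orP; right; apply: lb_le_inf.
  by exists (ln `|(tnth h j0)%:~R|); exists j0.
move=> _ [j /= hj <-]; rewrite -intr_norm -abszE.
apply: size_primes_ln_le; rewrite ?filter_uniq ?all_filter//.
- by apply: sub_all prs => p /= ->; rewrite implybT.
- by move=> p; rewrite mem_filter => /andP[/forallP].
- by move: hj; rewrite inE absz_gt0.
- exact: lt_le_trans b1.
- by move=> p; rewrite mem_filter => /andP[_ ps]; exact: bs.
Qed.

Lemma mem_primes_upper_half M p : (p \in primes_upper_half M) =
  (prime p && (uphalf M < p <= M)%N).
Proof.
rewrite mem_filter mem_iota/= add0n ltnS; case: (prime p) => //=.
by rewrite -andbA andbb.
Qed.

Lemma size_primes_upper_half M : (size (primes_upper_half M) <= M)%N.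
Proof.
have -> : primes_upper_half M =
    [seq p <- iota 1 M | prime p & (uphalf M < p <= M)%N] by [].
by rewrite (leq_trans (size_subseq (filter_subseq _ _)))// size_iota.
Qed.

End prime_divisors.

(** * Korobov p-sets *)

Section korobov.
Context {R : realType}.

Definition korobov d (p k n : nat) : d.-tuple (measurableTypeR R) :=
  mktuple (fun j : 'I_d => ((k * n ^ j.+1) %% p)%:R / p%:R : R).

Lemma korobov_in_cube d p k n : (0 < p)%N -> in_cube (korobov d p k n).
Proof.
move=> p0 j; rewrite tnth_mktuple divr_ge0//= ltr_pdivrMr ?ltr0n// mul1r.
by rewrite ltr_nat ltn_pmod.
Qed.

(** Reducing k n^(j+1) modulo p changes the phase by an integer multiple of
    2 pi, so the character is a k-th power, and its sum over k is geometric. *)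
Lemma cis_korobov d (p k n : nat) (h : d.-tuple int) : (0 < p)%N ->
  cis (2 * pi * dot h (korobov d p k n)) =
  cis (2 * pi * ((\sum_(j < d) tnth h j * (n ^ j.+1)%N%:Z)%R%:~R / p%:R) : R) ^+ k.
Proof.
move=> p0; have pR : p%:R != 0 :> R by rewrite pnatr_eq0 -lt0n.
rewrite -cisX -(cisD2pi_int _ (\sum_(j < d) tnth h j * ((k * n ^ j.+1) %/ p)%N%:Z)).
congr cis; rewrite -mulrDr -[RHS]mulrA; congr (_ * _).
rewrite /dot !rmorph_sum/= -big_split/= !mulr_suml; apply: eq_bigr => j _.
rewrite tnth_mktuple !rmorphM/= -!pmulrn -mulrDr -!mulrA; congr (_ * _).
have /(congr1 (fun i : nat => i%:R : R)) := divn_eq (k * n ^ j.+1) p.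
rewrite natrD !natrM => E.
have -> : (n ^ j.+1)%:R * (p%:R^-1 * k%:R) = (k%:R * (n ^ j.+1)%:R) / p%:R :> R by ring.
by rewrite E; field.
Qed.

End korobov.

(** * The cubature rule *)

Section korobov_rule.
Context {R : realType}.
Variables (d M : nat).
Local Notation P := (primes_upper_half M).

(** The pairs (weight, node).  Each p-set is averaged with weight 1 / p^2, and
    these averages are themselves averaged over the primes p. *)
Definition korobov_rule : seq (R * d.-tuple (measurableTypeR R)) :=
  [seq (((size P)%:R * p%:R ^+ 2)^-1, korobov d p nk.2 nk.1)
     | p <- P, nk <- [seq (n, k) | n <- iota 0 p, k <- iota 0 p]].

Lemma sum_korobov_rule (V : nmodType) (F : R -> d.-tuple (measurableTypeR R) -> V) :
  \sum_(x <- korobov_rule) F x.1 x.2 =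
  \sum_(p <- P) \sum_(n <- iota 0 p) \sum_(k <- iota 0 p)
    F ((size P)%:R * p%:R ^+ 2)^-1 (korobov d p k n).
Proof.
by rewrite big_allpairs_dep; apply: eq_bigr => p _; rewrite big_allpairs_dep.
Qed.

Lemma primes_upper_half_gt0 p : p \in P -> (0 < p)%N.
Proof. by rewrite mem_primes_upper_half => /andP[/prime_gt0]. Qed.

Lemma sum_weight_korobov_rule : (0 < size P)%N -> \sum_(x <- korobov_rule) x.1 = 1.
Proof.
move=> P0; rewrite (sum_korobov_rule (fun w _ => w)) big_seq.
rewrite (eq_bigr (fun _ => (size P)%:R^-1)) => [|p pP].
  rewrite -big_seq big_const_seq count_predT iter_addr_0 -[LHS]mulr_natr mulVf//.
  by rewrite pnatr_eq0 -lt0n.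
rewrite !big_const_seq !count_predT !size_iota !iter_addr_0 -mulrnA -[LHS]mulr_natr natrM.
have p0 : p%:R != 0 :> R by rewrite pnatr_eq0 -lt0n primes_upper_half_gt0.
by field; rewrite p0 pnatr_eq0 -lt0n P0.
Qed.

Lemma size_korobov_rule : (size korobov_rule <= M ^ 3)%N.
Proof.
rewrite size_allpairs_dep sumnE big_map expnS.
apply: (@leq_trans (size P * M ^ 2)); last by rewrite leq_mul2r size_primes_upper_half orbT.
rewrite mulnC -iter_addn_0 -[size P](count_predT) -big_const_seq.
rewrite big_seq [leqRHS]big_seq; apply: leq_sum => p.
rewrite mem_primes_upper_half size_allpairs !size_iota => /and3P[_ _ pM].
by rewrite -mulnn leq_mul.
Qed.

Lemma size_korobov_rule_gt0 : (0 < size P)%N -> (0 < size korobov_rule)%N.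
Proof.
move=> P0; rewrite lt0n; apply/negP => /eqP/size0nil r0.
by have := sum_weight_korobov_rule P0; rewrite r0 big_nil => /eqP; rewrite eq_sym oner_eq0.
Qed.

Lemma korobov_rule_in_cube x : x \in korobov_rule -> in_cube x.2.
Proof.
move=> /allpairsPdep[p [nk [pP _ ->]]]; apply: korobov_in_cube.
exact: primes_upper_half_gt0.
Qed.

(** The contribution of p is the proportion of n < p for which p divides
    h_1 n + ... + h_d n^d: at most d / p <= 2 d / M for an ordinary prime, and at
    most 1 for a prime dividing all components of h. *)
Lemma korobov_rule_character_le (h : d.-tuple int) : (0 < size P)%N ->
  Normc.normc (\sum_(x <- korobov_rule) x.1%:C%C * cis (2 * pi * dot h x.2)) <=
  2 * d%:R / M%:R +
  (size [seq p <- P | [forall j, (p %| `|tnth h j|)%N]])%:R / (size P)%:R.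
Proof.
move=> P0; have sP : (size P)%:R != 0 :> R by rewrite pnatr_eq0 -lt0n.
rewrite (sum_korobov_rule (fun w x => w%:C%C * cis (2 * pi * dot h x))).
apply: le_trans (normc_sum_le _ _ _) _.
have -> : 2 * d%:R / M%:R = \sum_(p <- P) (size P)%:R^-1 * (2 * d%:R / M%:R) :> R.
  by rewrite big_const_seq count_predT iter_addr_0 -[RHS]mulr_natl mulrA mulfV// mul1r.
have -> : (size [seq p <- P | [forall j, (p %| `|tnth h j|)%N]])%:R / (size P)%:R =
    \sum_(p <- P) (size P)%:R^-1 * ([forall j, (p %| `|tnth h j|)%N])%:R :> R.
  by rewrite -mulr_sumr -natr_sum mulrC size_filter -sum1_count big_mkcond.
rewrite -big_split/= big_seq [leRHS]big_seq; apply: ler_sum => p pP.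
have /and3P[pp Mp pM] : [&& prime p, (uphalf M < p)%N & (p <= M)%N].
  by rewrite -mem_primes_upper_half.
have p0 := prime_gt0 pp; have pR : (0 : R) < p%:R by rewrite ltr0n.
have MR : (0 : R) < M%:R by rewrite ltr0n (leq_trans p0).
under eq_bigr do rewrite -mulr_sumr.
rewrite -mulr_sumr normc_scale ?invr_ge0 ?mulr_ge0 ?exprn_ge0//.
rewrite invfM -[leLHS]mulrA -mulrDr ler_wpM2l ?invr_ge0//.
rewrite mulrC ler_pdivrMr ?exprn_gt0//.
apply: le_trans (normc_sum_le _ _ _) _.
pose a n := (p %| `|(\sum_(j < d) tnth h j * (n ^ j.+1)%N%:Z)%R|)%N.
apply: (@le_trans _ _ (\sum_(n <- iota 0 p) (a n * p)%N%:R)).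
  apply: ler_sum => n _; under eq_bigr do rewrite cis_korobov//.
  exact: normc_character_sum_le.
rewrite -natr_sum -big_distrl/=.
have -> : (\sum_(n <- iota 0 p) a n = count a (iota 0 p))%N.
  by rewrite -sum1_count [RHS]big_mkcond; apply: eq_bigr => n _; case: (a n).
have [hp|hp] := boolP [forall j, (p %| `|tnth h j|)%N].
  apply: (@le_trans _ _ (p%:R ^+ 2)).
    by rewrite -natrX ler_nat -mulnn leq_mul2r (leq_trans (count_size _ _)) ?orbT// size_iota.
  by rewrite ler_peMl ?exprn_ge0// lerDr divr_ge0// mulr_ge0.
rewrite addr0; apply: (@le_trans _ _ (d%:R * p%:R)).
  by rewrite -natrM ler_nat leq_mul2r count_roots_le ?orbT.
rewrite expr2 mulrA ler_wpM2r// mulrAC ler_pdivlMr//.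
rewrite -mulrA mulrCA ler_wpM2l// -natrM ler_nat.
lia.
Qed.

End korobov_rule.

(** The criterion is stated for any threshold E above e, so that it applies both
    to e itself and to e times the initial error. *)
Lemma information_complexity_le_size (R : realType) d
    (s : seq (R * d.-tuple (measurableTypeR R))) (e : R) (E : \bar R) :
  (e%:E <= E)%E -> 0 <= e -> (0 < size s)%N ->
  {in s, forall x, in_cube x.2} ->
  \sum_(x <- s) x.1 = 1 ->
  (forall h : d.-tuple int, h != zero_frequency ->
    Normc.normc (\sum_(x <- s) x.1%:C%C * cis (2 * pi * dot h x.2)) <=
      e * frequency_weight h) ->
  (information_complexity d E <= (size s)%:R%:E)%E.
Proof.
move=> eE e0 s0 scube s1 sh; apply: ereal_inf_lbound; exists (size s) => //.
split=> //; exists (fun n => (tnth (in_tuple s) n).1), (fun n => (tnth (in_tuple s) n).2).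
split=> [n|]; first by apply: scube; exact: mem_tnth.
apply: le_trans eE; apply: worst_case_error_le => //.
  by rewrite -[LHS](big_tnth _ _ s xpredT (fun x => x.1)).
move=> h h0; have := sh h h0; rewrite big_tnth; exact.
Qed.

(** * Tractability *)

Section tractability.
Context {R : realType}.
Variables (cP CP : R).
Hypothesis hP : prime_count_constants cP CP.

(** The number of exceptional primes is at most weight(h) / ln (M/2), which is at
    most 2 weight(h) / ln M because M >= 4, and there are at least c M / ln M
    primes; so the exceptional primes contribute at most 2 weight(h) / (c M).  The
    ordinary ones contribute at most 2 d / M <= 2 d weight(h) / (c M), as c <= 1
    and the weight is at least 1. *)
Lemma korobov_rule_error_le d M (h : d.-tuple int) : (0 < d)%N -> (4 <= M)%N ->
  h != zero_frequency ->
  Normc.normc (\sum_(x <- korobov_rule d M) x.1%:C%C * cis (2 * pi * dot h x.2)) <=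
  4 * d%:R / (cP * M%:R) * frequency_weight h.
Proof.
move=> d0 M4 h0; have [/andP[c0 c1] _ hM] := hP.
have M2 : (2 <= M)%N by exact: leq_trans M4.
have MR : 4 <= M%:R :> R by rewrite ler_nat.
have lnM0 : 0 < ln M%:R :> R by rewrite ln_gt0// ltr1n.
have /andP[Pc _] := hM M M2.
have P0 : 0 < (size (primes_upper_half M))%:R :> R.
  by apply: lt_le_trans Pc; rewrite mulr_gt0// divr_gt0//; lra.
apply: le_trans (korobov_rule_character_le _ _) _; first by rewrite -(ltr0n R).
have dR : 1 <= d%:R :> R by rewrite ler1n.
have w1 := frequency_weight_ge1 (R := R) h.
set c := size _; set w := frequency_weight h in w1 *.
have cw : c%:R * ln (M%:R / 2) <= w.
  apply: size_prime_divisors_ln_le => //.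
  - exact/filter_uniq/iota_uniq.
  - by apply/allP => p; rewrite mem_primes_upper_half => /andP[].
  - lra.
  - move=> p; rewrite mem_primes_upper_half => /and3P[_ Mp _].
    rewrite ler_pdivrMr// -natrM ler_nat; lia.
have ln2 : ln M%:R <= 2 * ln (M%:R / 2) :> R.
  rewrite mulr_natl -lnXn; last by lra.
  rewrite ler_ln ?posrE; [nra|lra|by rewrite exprn_gt0//; lra].
have cP_le : c%:R / (size (primes_upper_half M))%:R <= 2 * w / (cP * M%:R).
  rewrite ler_pdivrMr// mulrAC ler_pdivlMr; last by rewrite mulr_gt0//; lra.
  apply: (@le_trans _ _ (c%:R * (ln M%:R * (size (primes_upper_half M))%:R))).
    rewrite ler_wpM2l//; move: Pc.
    by rewrite mulrA ler_pdivrMr// [_ * ln _]mulrC.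
  rewrite mulrA ler_wpM2r//.
  apply: (@le_trans _ _ (c%:R * (2 * ln (M%:R / 2)))); first by rewrite ler_wpM2l.
  by rewrite mulrCA ler_wpM2l.
have d_le : 2 * d%:R / M%:R <= 2 * d%:R * w / (cP * M%:R).
  rewrite ler_pdivrMr; last lra.
  rewrite invfM mulrA mulfVK; last by rewrite gt_eqF//; lra.
  rewrite -mulrA ler_peMr//.
  by rewrite ler_pdivlMr// mul1r; lra.
apply: le_trans (lerD d_le cP_le) _.
rewrite -mulrDl [leRHS]mulrAC ler_wpM2r//; last nra.
by rewrite invr_ge0 mulr_ge0// ltW.
Qed.

Lemma information_complexity_le d (eps : R) (E : \bar R) : 0 < eps < 1 ->
  (0 < d)%N -> (eps%:E <= E)%E ->
  (information_complexity d E <=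
    ((8 * cP^-1) ^+ 3 * eps ^- 3 * d%:R ^+ 3)%:E)%E.
Proof.
move=> /andP[e0 e1] d0 eE; have [/andP[c0 c1] _ hM] := hP.
pose X : R := 8 * cP^-1 * eps^-1 * d%:R.
have dR : 1 <= d%:R :> R by rewrite ler1n.
have ci : 1 <= cP^-1 by rewrite invf_ge1// ltW.
have ei : 1 <= eps^-1 by rewrite invf_ge1// ltW.
have X8 : 8 <= X.
  by rewrite /X -!mulrA ler_peMr// mulr_ege1// mulr_ege1.
have X0 : 0 <= X by lra.
pose M := Num.truncn X.
have MX : M%:R <= X by rewrite truncn_le.
have XM : X < M.+1%:R by exact: truncnS_gt.
have M8 : (8 <= M)%N by rewrite truncn_ge_nat.
have M4 : (4 <= M)%N by exact: leq_trans M8.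
have MR : 8 <= M%:R :> R by rewrite ler_nat.
have P0 : (0 < size (primes_upper_half M))%N.
  have M2 : (2 <= M)%N by exact: leq_trans M8.
  have /andP[+ _] := hM M M2; rewrite -(ltr0n R); apply: lt_le_trans.
  by rewrite mulr_gt0// divr_gt0 ?ln_gt0 ?ltr1n//; lra.
have -> : (8 * cP^-1) ^+ 3 * eps ^- 3 * d%:R ^+ 3 = X ^+ 3.
  by rewrite /X !exprMn !exprVn.
apply: le_trans (information_complexity_le_size (s := korobov_rule d M) eE (ltW e0) _ _ _ _) _.
- exact: size_korobov_rule_gt0.
- exact: korobov_rule_in_cube.
- exact: sum_weight_korobov_rule.
- move=> h h0; apply: le_trans (korobov_rule_error_le d0 M4 h0) _.
  rewrite ler_wpM2r ?frequency_weight_ge0//.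
  rewrite ler_pdivrMr; last by rewrite mulr_gt0//; lra.
  (* As X >= 8, rounding X down to M at most halves it: X / 2 = 4 d / (c eps). *)
  have : X / 2 <= M%:R by move: XM; rewrite -natr1; lra.
  rewrite mulrA -ler_pdivrMl ?mulr_gt0//; apply: le_trans.
  rewrite /X invfM le_eqVlt; apply/orP; left; apply/eqP; field.
  by rewrite !gt_eqF.
- rewrite lee_fin; apply: (@le_trans _ _ ((M ^ 3)%N%:R)).
    by rewrite ler_nat size_korobov_rule.
  by rewrite natrX lerXn2r// nnegrE.
Qed.

End tractability.

Theorem corollary2p6 (R : realType) (cP CP : R)
    (hP : prime_count_constants cP CP)
    (eps : R) (heps : 0 < eps < 1) (d : nat) (hd : (0 < d)%N) :
  (N_nor eps d <= ((8 * cP^-1) ^+ 3 * eps ^- 3 * d%:R ^+ 3)%:E)%E /\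
  (N_abs eps d <= ((8 * cP^-1) ^+ 3 * eps ^- 3 * d%:R ^+ 3)%:E)%E.
Proof.
split; apply: (information_complexity_le hP heps hd) => //.
rewrite -[leLHS]mule1; apply: lee_wpmul2l; last exact: initial_error_ge1.
by case/andP: heps => e0 _; rewrite lee_fin ltW.
Qed.
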